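(* Let $1<q\le 2$ and let $\gamma>0$ be a constant. There is a constant $c=c(\gamma,q)$, depending only on $\gamma$ and $q$, such that the following holds. Let $X$ be a real Banach space whose modulus of smoothness satisfies $\rho(u)\le\gamma u^q$ for all $u>0$, let $\mathcal D\subset X$ be a dictionary, and let $f\in\mathcal A_1(\mathcal D)\subset X$. Then every output $(f_m)_{m\ge0}$ of the Rescaled Pure Greedy Algorithm RPGA($\mathcal D$) (run with these parameters $\gamma$ and $q$) applied to $f$ satisfies $$\|f-f_m\|\le c\,|f|_{\mathcal A_1(\mathcal D)}\,m^{\frac1q-1},\qquad m\ge2.$$
   Context: $X$ is a real Banach space with norm $\|\cdot\|$. Its modulus of smoothness is $$\rho(u):=\sup_{f,g\in X,\ \|f\|=\|g\|=1}\left\{\tfrac12(\|f+ug\|+\|f-ug\|)-1\right\},\quad u>0.$$ For $f\in X$, $f\ne0$, $F_f\in X^*$ denotes a norming functional of $f$: $\|F_f\|=1$ and $F_f(f)=\|f\|$. Dictionary: a set $\mathcal D\subset X$ with $\|\varphi\|=1$ for every $\varphi\in\mathcal D$ such that the closure of $\mathrm{span}(\mathcal D)$ is $X$. For $M>0$ let $\mathcal A_1^{o}(\mathcal D,M)$ be the set of all finite sums $\sum_{k\in\Lambda}c_k\varphi_k$ with $\varphi_k\in\mathcal D$, $|\Lambda|<\infty$ and $\sum_{k\in\Lambda}|c_k|\le M$, and let $\mathcal A_1(\mathcal D,M)$ be its closure in $X$. Put $\mathcal A_1(\mathcal D)=\bigcup_{M>0}\mathcal A_1(\mathcal D,M)$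 and, for $f\in\mathcal A_1(\mathcal D)$, $|f|_{\mathcal A_1(\mathcal D)}=\inf\{M: f\in\mathcal A_1(\mathcal D,M)\}$. RPGA($\mathcal D$) in $X$, applied to $f$, produces a sequence $(f_m)_{m\ge0}$ as follows. Step 0: $f_0:=0$. Step $m\ge1$: if $f_{m-1}=f$, the algorithm stops and $f_k:=f$ for all $k\ge m$. If $f_{m-1}\ne f$, choose $\varphi_m\in\mathcal D$ such that $$|F_{f-f_{m-1}}(\varphi_m)|=\sup_{\varphi\in\mathcal D}|F_{f-f_{m-1}}(\varphi)|$$ (it is assumed that such a choice exists at each step; it need not be unique), and set $$\lambda_m:=\mathrm{sign}\{F_{f-f_{m-1}}(\varphi_m)\}\,\|f-f_{m-1}\|\,(2\gamma q)^{\frac1{1-q}}\,|F_{f-f_{m-1}}(\varphi_m)|^{\frac1{q-1}},\qquad \hat f_m:=f_{m-1}+\lambda_m\varphi_m.$$ Choose $s_m\in\mathbb R$ such that $\|f-s_m\hat f_m\|=\min_{s\in\mathbb R}\|f-s\hat f_m\|$ and put $f_m:=s_m\hat f_m$. *)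

(* Defs.v *)
From HB Require Import structures.
From mathcomp Require Import all_boot all_order all_algebra.
From mathcomp Require Import all_classical all_reals all_analysis.

Set Implicit Arguments.
Unset Strict Implicit.
Unset Printing Implicit Defensive.

Import Order.TTheory GRing.Theory Num.Theory.
Import numFieldNormedType.Exports.

Local Open Scope classical_set_scope.
Local Open Scope ring_scope.

Section BanachNotions.
Context {R : realType}.

(* The set below is bounded above by u; it is empty only when X = {0}, and then
   [sup] gives 0. *)
Definition modulus_of_smoothness (X : normedModType R) (u : R) : R :=
  sup [set 2^-1 * (`|f + u *: g| + `|f - u *: g|) - 1
      | f in [set f : X | `|f| = 1] & g in [set g : X | `|g| = 1]].

Section Space.
Context {X : normedModType R}.

(* Meaningful for continuous F: [sup] of a set unbounded above is 0. *)
Definition dual_norm (F : {linear X -> R^o}) : R :=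
  sup [set `|F x : R| | x in [set x : X | `|x| <= 1]].

Definition norming_functional (f : X) (F : {linear X -> R^o}) : Prop :=
  [/\ continuous F, dual_norm F = 1 & F f = `|f|].

Definition linear_span (D : set X) : set X :=
  [set x | exists n (c : 'I_n -> R) (phi : 'I_n -> X),
     (forall k, D (phi k)) /\ x = \sum_(k < n) c k *: phi k].

Definition dictionary (D : set X) : Prop :=
  (forall phi, D phi -> `|phi| = 1) /\ closure (linear_span D) = setT.

(* A1o and A1_M are meant for M > 0. *)
Definition A1o (D : set X) (M : R) : set X :=
  [set x | exists n (c : 'I_n -> R) (phi : 'I_n -> X),
     [/\ forall k, D (phi k), x = \sum_(k < n) c k *: phi k
       & \sum_(k < n) `|c k| <= M]].

Definition A1_M (D : set X) (M : R) : set X := closure (A1o D M).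

Definition A1 (D : set X) : set X := \bigcup_(M in [set M : R | 0 < M]) A1_M D M.

Definition A1_norm (D : set X) (f : X) : R :=
  inf [set M : R | 0 < M /\ A1_M D M f].

(* [rpga_step gamma q D f g g']: from the current approximant g <> f of f, the
   algorithm may produce g' as the next one.  F is any norming functional of
   the residual f - g. *)
Definition rpga_step (gamma q : R) (D : set X) (f g g' : X) : Prop :=
  exists (F : {linear X -> R^o}) (phi : X) (s : R),
    let lambda := Num.sg (F phi : R) * `|f - g|
                  * (2 * gamma * q) `^ (1 / (1 - q))
                  * `|F phi : R| `^ (1 / (q - 1)) in
    let fhat := g + lambda *: phi in
    [/\ norming_functional (f - g) F,
        D phi,
        `|F phi : R| = sup [set `|F psi : R| | psi in D],
        forall t : R, `|f - s *: fhat| <= `|f - t *: fhat|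
      & g' = s *: fhat].

Definition rpga_output (gamma q : R) (D : set X) (f : X) (f_ : nat -> X) : Prop :=
  f_ 0%N = 0 /\
  forall m : nat,
    (f_ m = f -> f_ m.+1 = f) /\
    (f_ m <> f -> rpga_step gamma q D f (f_ m) (f_ m.+1)).

End Space.
End BanachNotions.

(* Main.v *)
Require Import Defs.
From mathcomp Require Import all_boot all_order all_algebra.
From mathcomp Require Import all_classical all_reals all_analysis.
From mathcomp Require Import ring lra.

Import Order.TTheory GRing.Theory Num.Theory.
Import numFieldNormedType.Exports.

Local Open Scope classical_set_scope.
Local Open Scope ring_scope.

(** Write e = f - f_m, E = ||e||, p = q / (q - 1), a = sup_D |F_e|.  Smoothness
    gives ||e + y|| <= E + F_e(y) + 2 gamma E (||y|| / E)^q.  Since f_m is the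
    best approximant of f on its own line, this forces F_e(f_m) = 0, so
    E = F_e(f) <= M a whenever f is in A_1(D, M).  The step length lambda
    minimizes the smoothness bound along phi_m, whence
    E_{m+1} <= E (1 - c1 a^p) <= E (1 - c1 (E / M)^p).  Thus
    y_m = c1 (E_m / M)^p satisfies y_{m+1} <= y_m (1 - y_m), which forces
    y_m <= 1 / m; taking the infimum over M concludes. *)

(** * Real powers and real sequences *)

Lemma powR_mulrB1 (R : realType) (q x : R) :
  1 < q -> 0 <= x -> x `^ q = x * x `^ (q - 1).
Proof.
move=> q1 x0; rewrite -{2}[x]powRr1 // -powRD ?subrKC //.
by apply/implyP => /eqP; lra.
Qed.

(** For q > 1, v^q is o(v) as v tends to 0, so a positive slope d would violate the bound at small
    v. *)
Lemma le0_of_linear_le_powR (R : realType) (q K d : R) : 1 < q -> 0 <= K ->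
  (forall v : R, 0 < v -> d * v <= K * v `^ q) -> d <= 0.
Proof.
move=> q1 K0 dK; rewrite leNgt; apply/negP => d0.
have K1 : 0 < K + 1 by lra.
have w0 : 0 < d / (K + 1) by rewrite divr_gt0.
(* v is chosen so that v^(q-1) = d / (K + 1), making K v^q < d v. *)
set v := (d / (K + 1)) `^ (1 / (q - 1)).
have v0 : 0 < v by rewrite powR_gt0.
have vq : v `^ (q - 1) = d / (K + 1).
  rewrite -powRrM divfK ?powRr1 ?ltW //; apply/eqP; lra.
have := dK _ v0; rewrite powR_mulrB1 ?(ltW v0) // vq mulrCA mulrC ler_pM2l //.
rewrite mulrA ler_pdivlMr //; nra.
Qed.

Lemma le1_mul_of_quadratic_decay (R : realType) (y : nat -> R) :
  (forall m, 0 <= y m) -> (forall m, y m.+1 <= y m * (1 - y m)) ->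
  forall m, y m.+1 * m.+1%:R <= 1.
Proof.
move=> y0 ystep; elim=> [|m IH].
  (* z (1 - z) <= 1/4 for every real z, so the induction starts whatever the size of y_0. *)
  by rewrite mulr1; have := ystep 0%N; nra.
have ym := y0 m.+1; have m1 : 1 <= m.+1%:R :> R by rewrite ler1n.
have := ystep m.+1; rewrite -(natr1 m.+1).
move: IH; set n := m.+1%:R in m1 *; set z := y m.+1 in ym * => IH zz.
(* 1 - (n+1) z (1 - z) = (1 - n z) (1 - z) + z^2 *)
have z1 : z <= 1 by nra.
have H : 0 <= (1 - z * n) * (1 - z) by rewrite mulr_ge0 // subr_ge0.
have : y m.+2 * (n + 1) <= z * (1 - z) * (n + 1) by rewrite ler_wpM2r //; lra.
nra.
Qed.

(** * Norming functionals and the modulus of smoothness *)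

Section SmoothSpace.
Context {R : realType} {X : normedModType R}.
Implicit Types (x y f : X) (F : {linear X -> R^o}) (D : set X).

Lemma norming_functional_le x F y :
  norming_functional x F -> `|F y : R| <= `|y|.
Proof.
case=> _ F1 _; have [->|y0] := eqVneq y 0; first by rewrite linear0 !normr0.
have ny : 0 < `|y| by rewrite normr_gt0.
(* On an unbounded set [sup] defaults to 0, which [dual_norm F = 1] excludes. *)
have hs : has_sup [set `|F x : R| | x in [set x : X | `|x| <= 1]].
  apply: contrapT => /sup_out; rewrite -/(dual_norm F) F1 => /eqP.
  by rewrite oner_eq0.
have : `|F (`|y|^-1 *: y) : R| <= 1.
  rewrite -F1; apply: ub_le_sup; first exact: hs.2.
  by exists (`|y|^-1 *: y) => //=; rewrite normrZ normfV normr_id mulVf ?gt_eqF.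
by rewrite linearZ /= normrM normfV normr_id ler_pdivrMl // mulr1.
Qed.

Lemma modulus_of_smoothness_ge (u : R) x y : 0 < u -> `|x| = 1 -> `|y| = 1 ->
  2^-1 * (`|x + u *: y| + `|x - u *: y|) - 1 <= modulus_of_smoothness X u.
Proof.
move=> u0 x1 y1; apply: ub_le_sup; last by exists x => //; exists y.
(* The triangle inequality bounds the set by u, so its [sup] is a true upper bound. *)
exists u => _ [a /= a1 [b /= b1 <-]].
have := ler_normD a (u *: b); have := ler_normB a (u *: b).
by rewrite normrZ a1 b1 gtr0_norm //; lra.
Qed.

(** On a finite sum the bound holds term by term; passing to the closure costs at most e, since F is
    1-Lipschitz. *)
Lemma norming_functional_A1_le x F D (M a : R) f : norming_functional x F ->
  0 <= a -> (forall phi, D phi -> `|F phi : R| <= a) ->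
  A1_M D M f -> (F f : R) <= M * a.
Proof.
move=> nF a0 Da fM; apply/ler_addgt0Pr => e e0.
have [z [[n [c [phi [Dphi zE cM]]]] fz]] := fM _ (nbhsx_ballx f e e0).
move: fz; rewrite -ball_normE /= => fz.
rewrite -[f](subrK z) linearD addrC; apply: lerD; last first.
  apply: le_trans (ler_norm _) _.
  exact: le_trans (norming_functional_le _ _ _ nF) (ltW fz).
rewrite zE linear_sum; apply: (@le_trans _ _ (\sum_(k < n) `|c k| * a)).
  apply: ler_sum => k _; rewrite linearZ /=.
  apply: le_trans (ler_norm _) _.
  by rewrite normrM ler_wpM2l // Da.
by rewrite -mulr_suml ler_wpM2r.
Qed.

Section PowerType.
Variables q gamma : R.
Hypotheses (q_gt1 : 1 < q) (gamma_gt0 : 0 < gamma).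
Hypothesis smooth :
  forall u : R, 0 < u -> modulus_of_smoothness X u <= gamma * u `^ q.

(** The modulus at u = ||y|| / ||x||, taken at the normalized vectors, bounds ||x + y|| + ||x - y||;
    then subtract ||x - y|| >= F(x - y) = ||x|| - F(y). *)
Lemma norming_functional_smooth x F y : x != 0 -> norming_functional x F ->
  `|x + y| <= `|x| + (F y : R) + 2 * gamma * `|x| * (`|y| / `|x|) `^ q.
Proof.
move=> x0 nF; have [_ _ Fx] := nF.
have nx : 0 < `|x| by rewrite normr_gt0.
have [->|y0] := eqVneq y 0.
  by rewrite linear0 !addr0 lerDl !mulr_ge0 ?powR_ge0 // ltW.
have ny : 0 < `|y| by rewrite normr_gt0.
have nxN : `|x| != 0 by rewrite gt_eqF.
have nyN : `|y| != 0 by rewrite gt_eqF.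
set u := `|y| / `|x|; have u0 : 0 < u by rewrite divr_gt0.
have unit_norm (z : X) : z != 0 -> `| `|z|^-1 *: z | = 1.
  by move=> z0; rewrite normrZ normfV normr_id mulVf // normr_eq0.
have := modulus_of_smoothness_ge u _ _ u0 (unit_norm _ x0) (unit_norm _ y0).
have uy : u *: (`|y|^-1 *: y) = `|x|^-1 *: y.
  by rewrite scalerA /u mulrAC divff // mul1r.
rewrite uy -scalerDr -scalerBr !normrZ normfV normr_id.
move=> /le_trans/(_ (smooth u u0)).
have Fxy : `|x| - (F y : R) <= `|x - y|.
  apply: le_trans (norming_functional_le _ _ (x - y) nF).
  by rewrite linearB Fx ler_norm.
rewrite -mulrDr => H.
have : `|x + y| + `|x - y| <= 2 * `|x| * (1 + gamma * u `^ q).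
  have -> : `|x + y| + `|x - y| =
      2 * `|x| * (2^-1 * (`|x|^-1 * (`|x + y| + `|x - y|))) by field.
  by rewrite ler_pM2l ?mulr_gt0 //; lra.
by move: Fxy; set Fy := (F y : R); lra.
Qed.

(** Minimality against u = v and u = -v bounds both F(y) v and -F(y) v by K v^q for v > 0, so the
    first-order term vanishes. *)
Lemma norming_functional_orthogonal x F y : x != 0 -> norming_functional x F ->
  (forall u : R, `|x| <= `|x + u *: y|) -> F y = 0.
Proof.
move=> x0 nF xmin.
have nx : 0 < `|x| by rewrite normr_gt0.
pose K := 2 * gamma * `|x| * (`|y| / `|x|) `^ q.
have K0 : 0 <= K by rewrite !mulr_ge0 ?powR_ge0 // ltW.
have H (u : R) : - (u * (F y : R)) <= K * `|u| `^ q.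
  have := le_trans (xmin u) (norming_functional_smooth _ _ (u *: y) x0 nF).
  have -> : (F (u *: y) : R) = u * (F y : R) by rewrite linearZ.
  rewrite normrZ -[_ * _ / `|x|]mulrA (powRM _ (normr_ge0 u)) ?divr_ge0 //.
  rewrite /K mulrA mulrAC; lra.
apply/eqP; rewrite eq_le; apply/andP; split.
  apply: (le0_of_linear_le_powR _ _ _ _ q_gt1 K0) => v v0.
  by have := H (- v); rewrite normrN gtr0_norm // mulNr opprK mulrC.
rewrite -oppr_le0.
apply: (le0_of_linear_le_powR _ _ _ _ q_gt1 K0) => v v0.
by have := H v; rewrite gtr0_norm // mulNr mulrC.
Qed.

(** * Error decay in one step of the algorithm *)

Let p : R := q / (q - 1).
(** The factor 1 - 1/q is the share of the linear gain left after paying the smoothness term; the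
    power is the constant in the step length. *)
Let c1 : R := (1 - 1 / q) * (2 * gamma * q) `^ (1 / (1 - q)).

(** Multiples of g' stay on the line of [fhat], where s is optimal. This supplies the minimality
    hypothesis of [rpga_step_decay] for the next step. *)
Lemma rpga_step_minimal D f g g' (u : R) : rpga_step gamma q D f g g' ->
  `|f - g'| <= `|f - g' + u *: g'|.
Proof.
move=> [F [phi [s [_ _ _ smin ->]]]].
set h := g + _ in smin *.
apply: le_trans (smin (s - u * s)) _.
by rewrite scalerBl scalerA opprB addrCA addrC.
Qed.

Lemma rpga_step_decay D f g g' (M : R) :
  dictionary D -> 0 < M -> A1_M D M f -> f - g != 0 ->
  (forall u : R, `|f - g| <= `|f - g + u *: g|) ->
  rpga_step gamma q D f g g' ->
  `|f - g'| <= `|f - g| * (1 - c1 * (`|f - g| / M) `^ p).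
Proof.
move=> [D1 _] M0 fM fg0 gmin [F [phi [s [nF Dphi Fphi smin ->]]]].
have q0 : 0 < q := lt_trans ltr01 q_gt1.
have q1' : 0 < q - 1 by rewrite subr_gt0.
have q10 : q - 1 != 0 by rewrite gt_eqF.
have q1n : 1 - q != 0 by rewrite subr_eq0 lt_eqF.
set e := f - g in fg0 gmin nF Fphi smin *.
set a : R := `|F phi : R| in Fphi smin *.
set E := `|e| in smin *.
have E0 : 0 < E by rewrite normr_gt0.
have a0 : 0 <= a by exact: normr_ge0.
have aD psi : D psi -> `|F psi : R| <= a.
  move=> Dpsi; rewrite Fphi; apply: ub_le_sup; last by exists psi.
  by exists 1 => _ [z Dz <-]; rewrite -(D1 z Dz) (norming_functional_le _ _ _ nF).
have EM : E / M <= a.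
  rewrite ler_pdivrMr // mulrC.
  have [_ _ Fe] := nF.
  (* Hence E = F(e) = F(f), to which the A_1 bound applies. *)
  have Fg : (F g : R) = 0 by apply: norming_functional_orthogonal nF gmin.
  apply: le_trans (norming_functional_A1_le _ _ _ _ _ _ nF a0 aD fM).
  by rewrite -[f](subrK g) linearD /= -/e Fe Fg addr0.
set B := (2 * gamma * q) `^ (1 / (1 - q)) in smin.
pose t := B * a `^ (1 / (q - 1)).
have B0 : 0 <= B by exact: powR_ge0.
have t0 : 0 <= t by rewrite mulr_ge0 // powR_ge0.
have gq0 : 0 < 2 * gamma * q by rewrite !mulr_gt0.
(* t is the root of 2 gamma q t^(q-1) = a. *)
have tq : 2 * gamma * t `^ q = t * a / q.
  rewrite powR_mulrB1 // /t powRM ?powR_ge0 // -/t.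
  rewrite -[(a `^ _) `^ _]powRrM divfK // powRr1 // /B -powRrM.
  have -> : 1 / (1 - q) * (q - 1) = -1 by field.
  by rewrite powR_inv1 ?ltW //; field; rewrite !gt_eqF.
have ta : t * a = B * a `^ p.
  have r0 : 0 < 1 / (q - 1) + 1 by rewrite addr_gt0 ?divr_gt0.
  rewrite /t -mulrA -{2}[a]powRr1 // -powRD ?(gt_eqF r0) //.
  by congr (_ * _ `^ _); rewrite /p; field.
set la := Num.sg _ * _ * _ * _ in smin.
have laE : la = Num.sg (F phi : R) * (E * t) by rewrite /la /t !mulrA.
(* The sign in la makes the linear term a decrease of size E t a. *)
have laF : la * (F phi : R) = E * (t * a).
  by rewrite laE mulrAC -normrEsg -/a mulrCA [a * t]mulrC.
have laN : `|la| <= E * t.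
  rewrite laE normrM (ger0_norm (mulr_ge0 (ltW E0) t0)) ler_piMl //.
    by rewrite mulr_ge0 // ltW.
  by rewrite normr_sg; case: (_ != 0).
(* The optimal scale is at least as good as 1, so it suffices to bound ||e - la phi||. *)
apply: le_trans (smin 1) _; rewrite scale1r opprD addrA -/e.
have := norming_functional_smooth _ _ (- (la *: phi)) fg0 nF.
rewrite -/E => /le_trans; apply.
have -> : (F (- (la *: phi)) : R) = - (E * (t * a)).
  by rewrite -laF linearN linearZ.
rewrite normrN normrZ (D1 _ Dphi) mulr1.
have tE : (`|la| / E) `^ q <= t `^ q.
  apply: ge0_ler_powR; rewrite ?nnegrE ?divr_ge0 ?(ltW q0) ?(ltW E0) //.
  by rewrite ler_pdivrMr // mulrC.
have H1 : 2 * gamma * E * (`|la| / E) `^ q <= E * (t * a / q).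
  rewrite -tq [2 * gamma * E]mulrC -[E * _ * _]mulrA ler_pM2l //.
  by rewrite ler_pM2l // mulr_gt0.
have H2 : c1 * (E / M) `^ p <= (1 - 1 / q) * (t * a).
  rewrite ta /c1 -/B -[_ * B * _]mulrA ler_wpM2l //.
    by rewrite subr_ge0 ler_pdivrMr // mul1r ltW.
  by rewrite ler_wpM2l // ge0_ler_powR ?nnegrE // ?divr_ge0 ?ltW.
have H3 : E * (c1 * (E / M) `^ p) <= E * (t * a) - E * (t * a / q).
  rewrite -mulrBr ler_pM2l //; apply: le_trans H2 _.
  by rewrite mulrBl div1r mul1r [q^-1 * _]mulrC.
rewrite mulrBr mulr1; lra.
Qed.

(** * Convergence rate *)

Lemma rpga_error_le D f (f_ : nat -> X) (M : R) m :
  dictionary D -> 0 < M -> A1_M D M f -> rpga_output gamma q D f f_ ->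
  `|f - f_ m.+1| <= M * (c1 * m.+1%:R) `^ (- p^-1).
Proof.
move=> dD M0 fM [f00 fS].
have q0 : 0 < q := lt_trans ltr01 q_gt1.
have q1' : 0 < q - 1 by rewrite subr_gt0.
have p0 : 0 < p by rewrite divr_gt0.
have p1 : 1 <= p by rewrite ler_pdivlMr // mul1r gerBl.
have c10 : 0 < c1.
  by rewrite mulr_gt0 ?powR_gt0 ?mulr_gt0 // subr_gt0 ltr_pdivrMr // mul1r.
(* At k = 0 the line is {0}; at k + 1 the approximant comes from a genuine step, as stopping earlier
   would give f itself. *)
have fmin k (u : R) : f_ k <> f -> `|f - f_ k| <= `|f - f_ k + u *: f_ k|.
  case: k => [|k] fk; first by rewrite f00 scaler0 addr0.
  have [f1 f2] := fS k.
  have fk' : f_ k <> f by move=> /f1.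
  exact: rpga_step_minimal (f2 fk').
have zM k : 0 <= `|f - f_ k| / M by rewrite divr_ge0 // ltW.
pose y k := c1 * (`|f - f_ k| / M) `^ p.
have y0 k : 0 <= y k by rewrite mulr_ge0 ?powR_ge0 // ltW.
have ystep k : y k.+1 <= y k * (1 - y k).
  have [fk|fk] := pselect (f_ k = f).
    have [/(_ fk) fk1 _] := fS k.
    by rewrite /y fk fk1 subrr normr0 mul0r powR0 ?gt_eqF // mulr0 mul0r.
  have e0 : f - f_ k != 0 by rewrite subr_eq0; apply/eqP => /esym.
  have [_ /(_ fk) stepk] := fS k.
  have := rpga_step_decay _ _ _ _ _ dD M0 fM e0 (fun u => fmin k u fk) stepk.
  rewrite -/(y k) => H.
  have E0 : 0 < `|f - f_ k| by rewrite normr_gt0.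
  (* E (1 - y_k) dominates a norm, so it is nonnegative. *)
  have y1 : 0 <= 1 - y k by rewrite -(pmulr_rge0 _ E0); apply: le_trans H.
  rewrite {1 2}/y -mulrA ler_pM2l //.
  apply: (@le_trans _ _ ((`|f - f_ k| / M * (1 - y k)) `^ p)).
    apply: ge0_ler_powR; rewrite ?nnegrE ?zM ?(ltW p0) //.
      by rewrite mulr_ge0.
    by rewrite mulrAC ler_pM2r ?invr_gt0.
  rewrite powRM //; apply: ler_wpM2l; first exact: powR_ge0.
  (* Since p >= 1, x^p <= x for x in [0, 1]; x = 0 is treated apart. *)
  have [->|z0] := eqVneq (1 - y k) 0; first by rewrite powR0 // gt_eqF.
  by apply: ge1r_powR => //; rewrite lt_neqAle eq_sym z0 y1 gerBl y0.
have n0 : 0 < m.+1%:R :> R by rewrite ltr0n.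
have H := le1_mul_of_quadratic_decay _ _ y0 ystep m.
have cn0 : 0 < c1 * m.+1%:R by rewrite mulr_gt0.
rewrite [M * _]mulrC -ler_pdivrMr // -mulN1r powRrM powR_inv1 ?(ltW cn0) //.
have <- : ((`|f - f_ m.+1| / M) `^ p) `^ p^-1 = `|f - f_ m.+1| / M.
  by rewrite -powRrM mulfV ?powRr1 // gt_eqF.
apply: ge0_ler_powR; rewrite ?nnegrE ?invr_ge0 ?powR_ge0 ?(ltW p0) ?(ltW cn0) //.
by rewrite -[leRHS]div1r ler_pdivlMr // mulrCA mulrA.
Qed.

End PowerType.

End SmoothSpace.

Theorem theorem5p3 (R : realType) (q gamma : R) (q_gt1 : 1 < q) (q_le2 : q <= 2)
    (gamma_gt0 : 0 < gamma) :
  exists c : R,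
    forall (X : completeNormedModType R) (D : set X) (f : X) (f_ : nat -> X),
      (forall u : R, 0 < u -> modulus_of_smoothness X u <= gamma * u `^ q) ->
      dictionary D ->
      A1 D f ->
      rpga_output gamma q D f f_ ->
      forall m : nat, (2 <= m)%N ->
        `|f - f_ m| <= c * A1_norm D f * m%:R `^ (1 / q - 1).
Proof.
pose c1 := (1 - 1 / q) * (2 * gamma * q) `^ (1 / (1 - q)).
exists (c1 `^ (- (q / (q - 1))^-1)).
move=> X D f f_ smooth dD [M0 /= M00 fM0] out [//|m] _.
have q0 : 0 < q := lt_trans ltr01 q_gt1.
have c10 : 0 < c1.
  by rewrite mulr_gt0 ?powR_gt0 ?mulr_gt0 // subr_gt0 ltr_pdivrMr // mul1r.
have -> : 1 / q - 1 = - (q / (q - 1))^-1.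
  by field; rewrite subr_eq0 !gt_eqF.
have n0 : 0 < m.+1%:R :> R by rewrite ltr0n.
have cn0 : 0 < c1 * m.+1%:R := mulr_gt0 c10 n0.
rewrite mulrAC -powRM ?(ltW c10) ?(ltW n0) // [_ * A1_norm _ _]mulrC.
(* Dividing by the rate leaves a quantity below every admissible M, hence below their infimum; M0
   shows that the set is nonempty. *)
rewrite -ler_pdivrMr ?powR_gt0 //.
apply: lb_le_inf; first by exists M0.
move=> M [M_gt0 fM]; rewrite ler_pdivrMr ?powR_gt0 //.
exact: (rpga_error_le _ _ q_gt1 gamma_gt0 smooth _ _ _ _ _ dD M_gt0 fM out).
Qed.
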